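(* Let $k$ be a field and let $A$ be a finite dimensional (associative unital) $k$-algebra. Then the linear map $$\Pi_A : \mathcal{T}_{\mathrm{Proj}_A} \to \mathrm{SLF}(A), \qquad t=(t_U)_{U\in \mathrm{Proj}_A} \mapsto \varphi^t, \quad \varphi^t(a) = t_A(\rho_a) \ \ (a \in A),$$ where $\rho_a \in \mathrm{End}_A(A)$ is $\rho_a(x) = xa$, is an isomorphism of vector spaces. In other words, $t_A$ entirely characterizes the trace $t=(t_U)$.
   Context: All modules are finite dimensional left modules. $\mathrm{Proj}_A$ is the full subcategory of the category of finite dimensional left $A$-modules whose objects are the projective $A$-modules. $A$ itself is viewed as a left $A$-module by left multiplication. A trace on $\mathrm{Proj}_A$ is a family of linear maps $t=(t_U : \mathrm{End}_A(U)\to k)_{U\in\mathrm{Proj}_A}$ such that for all $U,V \in \mathrm{Proj}_A$, all $f\in \mathrm{Hom}_A(U,V)$ and $g\in\mathrm{Hom}_A(V,U)$, $t_U(g\circ f) = t_V(f\circ g)$. $\mathcal{T}_{\mathrm{Proj}_A}$ is the vector space of traces on $\mathrm{Proj}_A$. $\mathrm{SLF}(A) = \{\varphi\in A^* \mid \varphi(xy)=\varphi(yx)\ \forall x,y\in A\}$ is the space of symmetric linear forms on $A$. *)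

(* Defs.v *)
From HB Require Import structures.
From mathcomp Require Import all_boot all_order all_algebra.
From mathcomp Require Import boolp.

Set Implicit Arguments.
Unset Strict Implicit.
Unset Printing Implicit Defensive.

Import GRing.Theory.
Local Open Scope ring_scope.

Definition finite_dimensional (k : fieldType) (V : lmodType k) : Prop :=
  exists (n : nat) (e : 'I_n -> V),
    forall v : V, exists c : 'I_n -> k, v = \sum_(i < n) c i *: e i.

(* A k-algebra is a ring with a ring morphism from k to its center. The library's
   [algType k] requires 1 != 0 and so excludes the zero algebra. *)
HB.mixin Record isAlgebraOver (k : fieldType) A of GRing.PzRing A := {
  alg_map : {rmorphism k -> A};
  alg_map_central : forall (c : k) (a : A), alg_map c * a = a * alg_map c
}.

#[short(type="algebraType")]
HB.structure Definition AlgebraOver (k : fieldType) :=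
  { A of GRing.PzRing A & isAlgebraOver k A }.

Section RestrictionOfScalars.
Context {k : fieldType} {A : algebraType k}.

Definition over_base (U : lmodType A) : Type := U.

Variable U : lmodType A.

HB.instance Definition _ := GRing.Zmodule.on (over_base U).

Definition base_scale (c : k) (u : over_base U) : over_base U :=
  (alg_map c : A) *: (u : U).

Fact base_scaleA c d u : base_scale c (base_scale d u) = base_scale (c * d) u.
Proof. by rewrite /base_scale scalerA rmorphM. Qed.

Fact base_scale1 : left_id 1 base_scale.
Proof. by move=> u; rewrite /base_scale rmorph1 scale1r. Qed.

Fact base_scaleDr : right_distributive base_scale +%R.
Proof. by move=> c u v; rewrite /base_scale scalerDr. Qed.

Fact base_scaleDl u : {morph base_scale^~ u : c d / c + d}.
Proof. by move=> c d; rewrite /base_scale rmorphD scalerDl. Qed.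

HB.instance Definition _ := GRing.Zmodule_isLmodule.Build k (over_base U)
  base_scaleA base_scale1 base_scaleDr base_scaleDl.

End RestrictionOfScalars.

HB.mixin Record isFinDimAlgebra (k : fieldType) A of AlgebraOver k A := {
  fdalg_finite_dimensional : finite_dimensional (over_base (A : algebraType k)^o)
}.

#[short(type="fdAlgType")]
HB.structure Definition FinDimAlgebra (k : fieldType) :=
  { A of AlgebraOver k A & isFinDimAlgebra k A }.

Definition projective (R : pzRingType) (P : lmodType R) : Prop :=
  forall (M N : lmodType R) (p : {linear M -> N}) (f : {linear P -> N}),
    (forall y : N, exists x : M, p x = y) ->
  exists g : {linear P -> M}, forall u : P, p (g u) = f u.

HB.mixin Record isFinDimProjective (k : fieldType) (A : fdAlgType k) U
    of GRing.Lmodule A U := {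
  projmod_finite_dimensional : finite_dimensional (over_base (U : lmodType A));
  projmod_projective : projective (U : lmodType A)
}.

HB.structure Definition ProjModule (k : fieldType) (A : fdAlgType k) :=
  { U of GRing.Lmodule A U & isFinDimProjective k A U }.
Notation projModType A := (@ProjModule.type _ A).

Section Regular.
Variables (k : fieldType) (A : fdAlgType k).

Fact regular_projective : projective (A^o : lmodType A).
Proof.
move=> M N p f p_surj; have [x px] := p_surj (f 1).
pose g (a : A^o) : M := (a : A) *: x.
have g_lin : linear g by move=> c a b; rewrite /g scalerDl scalerA.
pose gM := GRing.isLinear.Build A A^o M *:%R g g_lin.
pose gL : {linear A^o -> M} := HB.pack g gM.
exists gL => a; rewrite /= /g linearZ px -linearZ /=.
by congr (f _); rewrite /GRing.scale /= mulr1.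
Qed.

HB.instance Definition _ := isFinDimProjective.Build k A A^o
  fdalg_finite_dimensional regular_projective.

End Regular.

Lemma linear_ext (R : pzRingType) (U V : lmodType R) (f g : {linear U -> V}) :
  f =1 g -> f = g.
Proof.
move=> /funext; case: f g => [f [[f1] [f2]]] [g [[g1] [g2]]] /= fg.
case: _ / fg g1 g2 => g1 g2.
by congr (GRing.Linear.Pack (GRing.Linear.Class _ _));
  congr (_ _); apply: Prop_irrelevance.
Qed.

Section Homomorphisms.
Variables (k : fieldType) (A : algebraType k).

Definition homA (U V : lmodType A) : Type := {linear U -> V}.

Definition hom_fun (U V : lmodType A) (f : homA U V) : {linear U -> V} := f.
Coercion hom_fun : homA >-> GRing.Linear.type.

Definition hom_comp (U V W : lmodType A) (g : homA V W) (f : homA U V) :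
  homA U W := (hom_fun g \o hom_fun f)%FUN : {linear U -> W}.

Variables U V : lmodType A.
Implicit Types f g h : homA U V.

Definition hom_zero : homA U V := (\0 : U -> V) : {linear U -> V}.
Definition hom_opp f : homA U V := (\- hom_fun f) : {linear U -> V}.
Definition hom_add f g : homA U V := (hom_fun f \+ hom_fun g) : {linear U -> V}.

Fact hom_scale_linear (c : k) f :
  linear (fun u : U => (c *: (f u : over_base V) : V)).
Proof.
move=> a u v; rewrite linearP scalerDr.
by congr (_ + _); rewrite [LHS]scalerA [RHS]scalerA alg_map_central.
Qed.

Definition hom_scale (c : k) f : homA U V :=
  HB.pack_for {linear U -> V} (fun u : U => (c *: (f u : over_base V) : V))
    (GRing.isLinear.Build A U V *:%R _ (hom_scale_linear c f)).

HB.instance Definition _ := gen_eqMixin (homA U V).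
HB.instance Definition _ := gen_choiceMixin (homA U V).

Fact hom_addA : associative hom_add.
Proof. by move=> f g h; apply: linear_ext => u; apply: addrA. Qed.
Fact hom_addC : commutative hom_add.
Proof. by move=> f g; apply: linear_ext => u; apply: addrC. Qed.
Fact hom_add0 : left_id hom_zero hom_add.
Proof. by move=> f; apply: linear_ext => u; apply: add0r. Qed.
Fact hom_addN : left_inverse hom_zero hom_opp hom_add.
Proof. by move=> f; apply: linear_ext => u; apply: addNr. Qed.

HB.instance Definition _ := GRing.isZmodule.Build (homA U V)
  hom_addA hom_addC hom_add0 hom_addN.

Fact hom_scaleA c d f : hom_scale c (hom_scale d f) = hom_scale (c * d) f.
Proof. by apply: linear_ext => u; apply: (@scalerA k (over_base V)). Qed.
Fact hom_scale1 : left_id 1 hom_scale.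
Proof. by move=> f; apply: linear_ext => u; apply: (@scale1r k (over_base V)). Qed.
Fact hom_scaleDr : right_distributive hom_scale +%R.
Proof.
by move=> c f g; apply: linear_ext => u; apply: (@scalerDr k (over_base V)).
Qed.
Fact hom_scaleDl f : {morph hom_scale^~ f : c d / c + d}.
Proof.
by move=> c d; apply: linear_ext => u; apply: (@scalerDl k (over_base V)).
Qed.

HB.instance Definition _ := GRing.Zmodule_isLmodule.Build k (homA U V)
  hom_scaleA hom_scale1 hom_scaleDr hom_scaleDl.

End Homomorphisms.

Section Traces.
Variables (k : fieldType) (A : fdAlgType k).

Record trace := Trace {
  trace_fun :> forall U : projModType A, {linear homA U U -> k^o};
  trace_cyclic : forall (U V : projModType A) (f : homA U V) (g : homA V U),
    trace_fun U (hom_comp g f) = trace_fun V (hom_comp f g)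
}.

Lemma trace_ext (s t : trace) : (forall U, s U =1 t U) -> s = t.
Proof.
case: s t => [s s_cyc] [t t_cyc] /= st.
have {}st : s = t.
  by apply: functional_extensionality_dep => U; apply: linear_ext; apply: st.
by case: _ / st t_cyc => t_cyc; congr Trace; apply: Prop_irrelevance.
Qed.

(* A trace is indexed by all modules, so [trace] lives in too large a universe to
   be an [lmodType k]. Its vector space structure is given by the pointwise
   operations below, together with the laws they satisfy. *)
Definition trace_zero : trace.
Proof.
by exists (fun U : projModType A => \0 : {linear homA U U -> k^o}).
Defined.

Definition trace_opp (t : trace) : trace.
Proof.
exists (fun U : projModType A => (\- t U) : {linear homA U U -> k^o}).
by move=> U V f g /=; rewrite trace_cyclic.
Defined.

Definition trace_add (s t : trace) : trace.
Proof.
exists (fun U : projModType A => (s U \+ t U) : {linear homA U U -> k^o}).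
by move=> U V f g /=; rewrite !(trace_cyclic _ f g).
Defined.

Definition trace_scale (c : k) (t : trace) : trace.
Proof.
exists (fun U : projModType A => (c \*: t U) : {linear homA U U -> k^o}).
by move=> U V f g /=; rewrite trace_cyclic.
Defined.

Fact trace_addA : associative trace_add.
Proof. by move=> r s t; apply: trace_ext => U f; apply: addrA. Qed.
Fact trace_addC : commutative trace_add.
Proof. by move=> s t; apply: trace_ext => U f; apply: addrC. Qed.
Fact trace_add0 : left_id trace_zero trace_add.
Proof. by move=> t; apply: trace_ext => U f; apply: add0r. Qed.
Fact trace_addN : left_inverse trace_zero trace_opp trace_add.
Proof. by move=> t; apply: trace_ext => U f; apply: addNr. Qed.

Fact trace_scaleA c d t : trace_scale c (trace_scale d t) = trace_scale (c * d) t.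
Proof. by apply: trace_ext => U f; apply: scalerA. Qed.
Fact trace_scale1 : left_id 1 trace_scale.
Proof. by move=> t; apply: trace_ext => U f; apply: scale1r. Qed.
Fact trace_scaleDr : right_distributive trace_scale trace_add.
Proof. by move=> c s t; apply: trace_ext => U f; apply: scalerDr. Qed.
Fact trace_scaleDl c d t :
  trace_scale (c + d) t = trace_add (trace_scale c t) (trace_scale d t).
Proof. by apply: trace_ext => U f; apply: scalerDl. Qed.

End Traces.

Section SymmetricLinearForms.
Variables (k : fieldType) (A : fdAlgType k).

Record SLF := MkSLF {
  slf_fun :> {linear over_base (A^o : lmodType A) -> k^o};
  slf_sym : forall x y : A, slf_fun (x * y) = slf_fun (y * x)
}.

Lemma slf_ext (phi psi : SLF) : phi =1 psi -> phi = psi.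
Proof.
case: phi psi => [phi phi_sym] [psi psi_sym] /= eq_phi.
have {}eq_phi : phi = psi by apply: linear_ext; apply: eq_phi.
by case: _ / eq_phi psi_sym => psi_sym; congr MkSLF; apply: Prop_irrelevance.
Qed.

Implicit Types phi psi : SLF.

Definition slf_zero : SLF.
Proof. by exists (\0 : {linear over_base (A^o : lmodType A) -> k^o}). Defined.

Definition slf_opp phi : SLF.
Proof.
exists (\- phi : {linear over_base (A^o : lmodType A) -> k^o}).
by move=> x y /=; rewrite slf_sym.
Defined.

Definition slf_add phi psi : SLF.
Proof.
exists (phi \+ psi : {linear over_base (A^o : lmodType A) -> k^o}).
by move=> x y /=; rewrite !(slf_sym _ x y).
Defined.

Definition slf_scale (c : k) phi : SLF.
Proof.
exists (c \*: phi : {linear over_base (A^o : lmodType A) -> k^o}).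
by move=> x y /=; rewrite slf_sym.
Defined.

HB.instance Definition _ := gen_eqMixin SLF.
HB.instance Definition _ := gen_choiceMixin SLF.

Fact slf_addA : associative slf_add.
Proof. by move=> f g h; apply: slf_ext => a; apply: addrA. Qed.
Fact slf_addC : commutative slf_add.
Proof. by move=> f g; apply: slf_ext => a; apply: addrC. Qed.
Fact slf_add0 : left_id slf_zero slf_add.
Proof. by move=> f; apply: slf_ext => a; apply: add0r. Qed.
Fact slf_addN : left_inverse slf_zero slf_opp slf_add.
Proof. by move=> f; apply: slf_ext => a; apply: addNr. Qed.

HB.instance Definition _ := GRing.isZmodule.Build SLF
  slf_addA slf_addC slf_add0 slf_addN.

Fact slf_scaleA c d phi : slf_scale c (slf_scale d phi) = slf_scale (c * d) phi.
Proof. by apply: slf_ext => a; apply: scalerA. Qed.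
Fact slf_scale1 : left_id 1 slf_scale.
Proof. by move=> f; apply: slf_ext => a; apply: scale1r. Qed.
Fact slf_scaleDr : right_distributive slf_scale +%R.
Proof. by move=> c f g; apply: slf_ext => a; apply: scalerDr. Qed.
Fact slf_scaleDl phi : {morph slf_scale^~ phi : c d / c + d}.
Proof. by move=> c d; apply: slf_ext => a; apply: scalerDl. Qed.

HB.instance Definition _ := GRing.Zmodule_isLmodule.Build k SLF
  slf_scaleA slf_scale1 slf_scaleDr slf_scaleDl.

End SymmetricLinearForms.

Section RightMultiplication.
Variables (k : fieldType) (A : fdAlgType k) (a : A).

Fact rho_linear : linear (fun x : A^o => (x : A) * a : A^o).
Proof. by move=> b x y; rewrite mulrDl -mulrA. Qed.

Definition rho : homA (A^o : lmodType A) (A^o : lmodType A) :=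
  HB.pack_for {linear A^o -> A^o} (fun x : A^o => (x : A) * a : A^o)
    (GRing.isLinear.Build A A^o A^o *:%R _ rho_linear).

End RightMultiplication.

(* Main.v *)
(* A finitely generated projective module U has a dual basis (e_i, xi_i), so that
   id_U is the sum of the composites U -> A -> U of xi_i and x |-> x e_i. Cyclicity
   then forces t_U f = sum_i t_A (rho (xi_i (f e_i))), which gives injectivity.
   Conversely, for phi symmetric, f |-> sum_i phi (xi_i (f e_i)) is a trace: expand
   f e_i in a dual basis of V and swap the two resulting factors under phi. *)
Require Import Defs.
From HB Require Import structures.
From mathcomp Require Import all_boot all_order all_algebra.
From mathcomp Require Import boolp.
Import GRing.Theory.
Local Open Scope ring_scope.

Set Implicit Arguments.
Unset Strict Implicit.

(** The vectors need not be independent, so [db_form i (db_vec j)] need not be a Kronecker delta. *)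
Record dual_basis (k : fieldType) (A : fdAlgType k) (U : lmodType A) := DualBasis {
  db_size : nat;
  db_vec : 'I_db_size -> U;
  db_form : 'I_db_size -> {linear U -> A^o};
  db_expand : forall u : U, u = \sum_i (db_form i u : A) *: db_vec i
}.
Arguments db_vec {k A U} d i.
Arguments db_form {k A U} d i.
Arguments db_expand {k A U} d u.

Section DualBasis.
Variables (k : fieldType) (A : fdAlgType k).

Lemma lincomb_linear (U : lmodType A) n (e : 'I_n -> U) :
  linear (fun c : {ffun 'I_n -> A^o} => \sum_i (c i : A) *: e i).
Proof.
move=> a c d; rewrite scaler_sumr -big_split; apply: eq_bigr => i _.
by rewrite !ffunE scalerDl scalerA.
Qed.

Definition lincomb (U : lmodType A) n (e : 'I_n -> U) :
    {linear {ffun 'I_n -> A^o} -> U} :=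
  HB.pack_for {linear {ffun 'I_n -> A^o} -> U}
    (fun c : {ffun 'I_n -> A^o} => \sum_i (c i : A) *: e i)
    (GRing.isLinear.Build A _ U *:%R _ (lincomb_linear e)).

Lemma coord_linear (U : lmodType A) n (g : {linear U -> {ffun 'I_n -> A^o}}) i :
  linear (fun u : U => g u i).
Proof. by move=> a u v; rewrite linearP !ffunE. Qed.

Definition coord_form (U : lmodType A) n (g : {linear U -> {ffun 'I_n -> A^o}}) i :
    {linear U -> A^o} :=
  HB.pack_for {linear U -> A^o} (fun u : U => g u i)
    (GRing.isLinear.Build A U A^o *:%R _ (coord_linear g i)).

(** A family spanning [U] over [k] also generates it over [A], so [lincomb e] maps a free module
    onto [U]. Projectivity lifts the identity to a section, whose coordinates are the forms. *)
Lemma dual_basis_exists (U : projModType A) : exists b : dual_basis U, True.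
Proof.
have [n [e e_gen]] := @projmod_finite_dimensional _ _ U.
have e_surj (u : U) : exists c, lincomb e c = u.
  have [c ->] := e_gen u.
  exists [ffun i => alg_map (c i) : A^o].
  by apply: eq_bigr => i _; rewrite ffunE.
have [g gK] := @projmod_projective _ _ U _ _ (lincomb e) idfun e_surj.
by exists (@DualBasis k A U n e (coord_form g) (fun u => esym (gK u))).
Qed.

(** An arbitrary choice: even for [A^o] it need not be the single vector 1. *)
Definition dualb (U : projModType A) : dual_basis U :=
  projT1 (cid (dual_basis_exists U)).

End DualBasis.

Section TraceOfForm.
Variables (k : fieldType) (A : fdAlgType k) (phi : SLF A).

(** This is [phi] applied to the Hattori-Stallings trace of [f]. *)
Definition form_trace_fun (U : projModType A) (f : homA U U) : k^o :=
  \sum_i phi (db_form (dualb U) i (f (db_vec (dualb U) i))).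

Lemma slf_alg_map (c : k) (x : A) : phi (alg_map c * x) = c *: (phi x : k^o).
Proof. exact: (linearZ_LR (slf_fun phi)). Qed.

Lemma form_trace_linear U : linear (@form_trace_fun U).
Proof.
move=> c f g; rewrite /form_trace_fun scaler_sumr -big_split.
apply: eq_bigr => i _ /=.
rewrite linearD linearD /=; congr (_ + _).
by rewrite -slf_alg_map; congr (phi _); apply: (linearZ_LR (db_form _ i)).
Qed.

Definition form_trace_lin (U : projModType A) : {linear homA U U -> k^o} :=
  HB.pack_for {linear homA U U -> k^o} (@form_trace_fun U)
    (GRing.isLinear.Build k (homA U U) k^o *:%R _ (@form_trace_linear U)).

(** Puts [U] and [V] on an equal footing: exchanging [f] and [g] only exchanges the two sums and the
    two factors under [phi]. *)
Lemma form_trace_expand (U V : projModType A) (f : homA U V) (g : homA V U) :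
  form_trace_fun (hom_comp g f) =
  \sum_i \sum_j phi ((db_form (dualb V) j (f (db_vec (dualb U) i)) : A) *
                     (db_form (dualb U) i (g (db_vec (dualb V) j)) : A)).
Proof.
apply: eq_bigr => i _; rewrite /= {1}(db_expand (dualb V) (f _)) !linear_sum.
by apply: eq_bigr => j _; rewrite !linearZ.
Qed.

Lemma form_trace_cyclic (U V : projModType A) (f : homA U V) (g : homA V U) :
  form_trace_fun (hom_comp g f) = form_trace_fun (hom_comp f g).
Proof.
rewrite !form_trace_expand exchange_big.
by do 2!apply: eq_bigr => ? _; rewrite slf_sym.
Qed.

Definition form_trace : trace A :=
  @Trace k A form_trace_lin form_trace_cyclic.

End TraceOfForm.

Section FormOfTrace.
Variables (k : fieldType) (A : fdAlgType k).
Implicit Types t : trace A.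

Lemma rho_mul (a b : A) : rho (a * b) = hom_comp (rho b) (rho a).
Proof. by apply: linear_ext => x; apply: mulrA. Qed.

Lemma rho_base_linear : linear (fun a : over_base (A^o : lmodType A) => rho (a : A)).
Proof.
move=> c a b; apply: linear_ext => x /=; rewrite mulrDr; congr (_ + _).
(* The scalar sits between [x] and [a]; centrality of the image of [k] brings it to the front. *)
by rewrite [LHS]mulrA -alg_map_central -mulrA.
Qed.

Lemma trace_rho_linear t :
  linear (fun a : over_base (A^o : lmodType A) => t A^o (rho (a : A))).
Proof. by move=> c a b; rewrite rho_base_linear linearP. Qed.

Lemma trace_rho_sym t (x y : A) : t A^o (rho (x * y)) = t A^o (rho (y * x)).
Proof. by rewrite !rho_mul trace_cyclic. Qed.

Definition trace_form t : SLF A :=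
  @MkSLF k A
    (HB.pack_for {linear over_base (A^o : lmodType A) -> k^o}
      (fun a : over_base (A^o : lmodType A) => t A^o (rho (a : A)))
      (GRing.isLinear.Build k _ k^o *:%R _ (@trace_rho_linear t)))
    (trace_rho_sym t).

Lemma act_linear (U : lmodType A) (u : U) : linear (fun a : A^o => (a : A) *: u).
Proof. by move=> c a b; rewrite scalerDl scalerA. Qed.

Definition act_on (U : lmodType A) (u : U) : homA (A^o : lmodType A) U :=
  HB.pack_for {linear A^o -> U} (fun a : A^o => (a : A) *: u)
    (GRing.isLinear.Build A A^o U *:%R _ (act_linear u)).

Lemma hom_sumE (U V : lmodType A) n (F : 'I_n -> homA U V) (u : U) :
  (\sum_i F i : homA U V) u = \sum_i F i u.
Proof. by elim/big_rec2: _ => //= i v h _ <-. Qed.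

Lemma trace_dual_basis t (U : projModType A) (f : homA U U) :
  t U f = \sum_i t A^o (rho (db_form (dualb U) i (f (db_vec (dualb U) i)) : A)).
Proof.
set b := dualb U.
have {1}-> : f = \sum_i hom_comp (act_on (db_vec b i))
                          (hom_comp (db_form b i : homA _ _) f).
  by apply: linear_ext => u; rewrite hom_sumE {1}(db_expand b (f u)).
rewrite linear_sum; apply: eq_bigr => i _; rewrite trace_cyclic; congr (t _ _).
(* After cyclicity the endomorphism of [A^o] sends [x] to xi_i (f (x e_i)) = x xi_i (f e_i), which
   is a right multiplication. *)
by apply: linear_ext => x; rewrite /= !linearZ.
Qed.

End FormOfTrace.

Theorem theorem4p1 (k : fieldType) (A : fdAlgType k) :
  exists Pi : trace A -> SLF A,
    [/\ forall (t : trace A) (a : A), Pi t a = t A^o (rho a),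
        forall s t : trace A, Pi (trace_add s t) = Pi s + Pi t,
        forall (c : k) (t : trace A), Pi (trace_scale c t) = c *: Pi t,
        bijective Pi
      & forall s t : trace A, s A^o =1 t A^o -> s = t].
Proof.
have trace_inj (s t : trace A) : (forall a : A, s A^o (rho a) = t A^o (rho a)) -> s = t.
  by move=> st; apply: trace_ext => U f; rewrite !trace_dual_basis; apply: eq_bigr.
have form_traceE (phi : SLF A) (a : A) : form_trace phi A^o (rho a) = phi a.
  rewrite /= /form_trace_fun; set b := dualb _.
  (* Only the [a] on the right is expanded. The terms to compare are then phi (xi_i (e_i a)) = phi
     (e_i xi_i (a)) and phi (xi_i (a) e_i), equal by symmetry of [phi]. *)
  have {2}-> : a = \sum_i (db_form b i a : A) * db_vec b i.
    exact: (db_expand b (a : A^o)).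
  rewrite linear_sum; apply: eq_bigr => i _.
  by rewrite slf_sym /=; congr (phi _); apply: linearZ.
exists (@trace_form k A); split=> //.
- by move=> s t; apply: slf_ext.
- by move=> c t; apply: slf_ext.
- exists (@form_trace k A) => [t | phi]; last exact/slf_ext/form_traceE.
  (* A trace is determined by its values on right multiplications, and there [form_traceE] gives
     back those of [t]. *)
  by apply: trace_inj => a; rewrite form_traceE.
- by move=> s t st; apply: trace_inj => a; apply: st.
Qed.
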